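(* Let $n\in\mathbb N$, let $H_S\in\mathbb C^{n\times n}$ be Hermitian, and assume there exist $E_1\in\mathbb R$ and $\Delta E>0$ such that $\sigma(H_S)\subseteq\{E_1+j\Delta E:j\in\mathbb N_0\}$. For $T\in(0,\infty]$ let $\mathsf{TO}^{\Delta E}_{\mathsf{Spin}}(H_S,T)$ be the set of all maps $\Phi_{T,M}(H_B,e^{iH_{\mathrm{tot}}})$ where $m\in\mathbb N$, $\beta_1,\ldots,\beta_m\in\mathbb N=\{1,2,\ldots\}$, $M=\sum_{j=1}^m\beta_j$, $H_B=\bigoplus_{j=1}^m j\Delta E\,\mathbb 1_{\beta_j}$, and $H_{\mathrm{tot}}\in\mathbb C^{nM\times nM}$ is Hermitian with $[H_{\mathrm{tot}},H_S\otimes\mathbb 1_M+\mathbb 1_n\otimes H_B]=0$. Then for all $T\in(0,\infty]$: (a) $\overline{\mathsf{TO}^{\Delta E}_{\mathsf{Spin}}(H_S,T)}$ equals the closure of the set of all maps $\Phi_{T,M}(H_B,e^{iH_{\mathrm{tot}}})$ described in the same way but with $\beta_1,\ldots,\beta_m\in\mathbb N_0$ (zero allowed) subject to $\sum_{j=1}^m\beta_j>0$; (b) $\overline{\mathsf{TO}(H_S,T)}=\overline{\mathsf{TO}^{\Delta E}_{\mathsf{Spin}}(H_S,T)}$.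
   Context: For $m\in\mathbb N$, $H_B\in\mathbb C^{m\times m}$ Hermitian, $U\in\mathbb C^{mn\times mn}$ unitary and $T\in(0,\infty)$ define $$\Phi_{T,m}(H_B,U)(X):=\operatorname{tr}_B\Big(U\Big(X\otimes\frac{e^{-H_B/T}}{\operatorname{tr}(e^{-H_B/T})}\Big)U^*\Big),\qquad X\in\mathbb C^{n\times n},$$ where $\operatorname{tr}_B$ is the partial trace over the second tensor factor of $\mathbb C^n\otimes\mathbb C^m$. For $T=\infty$ the Gibbs state is replaced by the maximally mixed state: $\Phi_{\infty,m}(H_B,U)(X):=\operatorname{tr}_B(U(X\otimes\frac{1}{m}\mathbb 1_m)U^* )$. The set of thermal operations $\mathsf{TO}(H_S,T)$ consists of all $\Phi_{T,m}(H_B,U)$ with $m\in\mathbb N$, $H_B\in\mathbb C^{m\times m}$ Hermitian, and $U$ unitary satisfying $U(H_S\otimes\mathbb 1_m+\mathbb 1_n\otimes H_B)U^*=H_S\otimes\mathbb 1_m+\mathbb 1_n\otimes H_B$ (also imposed when $T=\infty$). A bar denotes closure in the finite-dimensional space of linear maps on $\mathbb C^{n\times n}$. *)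

(* Defs.v *)
From HB Require Import structures.
From mathcomp Require Import all_boot all_order all_algebra.
From mathcomp Require Import complex mxtens.
From mathcomp Require Import all_classical all_reals all_analysis.

Set Implicit Arguments.
Unset Strict Implicit.
Unset Printing Implicit Defensive.

Import Order.TTheory GRing.Theory Num.Theory numFieldNormedType.Exports.

Local Open Scope ring_scope.
Local Open Scope complex_scope.
Local Open Scope sesquilinear_scope.
Local Open Scope classical_set_scope.

(* The libraries do not attach a topology to the concrete type R[i]. These
   instances give it the one induced by the complex modulus, exactly as
   numFieldNormedType does for an abstract numFieldType; matrices over R[i]
   then inherit the norm topology. *)
Set Warnings "-redundant-canonical-projection".
HB.instance Definition _ (R : realType) := PseudoPointedMetric.copy R[i] R[i]^o.
HB.instance Definition _ (R : realType) := NormedModule.copy R[i] R[i]^o.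

Definition expmx (R : realType) (p : nat) (A : 'M[R[i]]_p) : 'M[R[i]]_p :=
  limn (series (fun k => (k`!%:R)^-1 *: A ^+ k)).

(* tensmx identifies C^n (x) C^m with C^(n * m) through mxtens_index, so the
   second factor of a pair (i, k) is the one traced out. *)
Definition ptraceB (R : realType) (n m : nat) (A : 'M[R[i]]_(n * m)) :
    'M[R[i]]_n :=
  \matrix_(i, j) \sum_(k < m) A (mxtens_index (i, k)) (mxtens_index (j, k)).

(* The temperature lives in \bar R so that T = +oo is allowed; the value at
   T = -oo is irrelevant, as only 0 < T is ever considered. *)
Definition gibbs (R : realType) (T : \bar R) (m : nat) (HB : 'M[R[i]]_m) :
    'M[R[i]]_m :=
  match T with
  | t%:E => let G := expmx (- (t^-1)%:C *: HB) in (\tr G)^-1 *: G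
  | _ => (m%:R)^-1 *: 1%:M
  end.

Definition thermal_map (R : realType) (n : nat) (T : \bar R) (m : nat)
    (HB : 'M[R[i]]_m) (U : 'M[R[i]]_(n * m)) (X : 'M[R[i]]_n) : 'M[R[i]]_n :=
  ptraceB (U *m tensmx X (gibbs T HB) *m U ^t*).

Fact thermal_map_is_linear (R : realType) (n : nat) (T : \bar R) (m : nat)
    (HB : 'M[R[i]]_m) (U : 'M[R[i]]_(n * m)) : linear (thermal_map T HB U).
Proof.
move=> a X Y; rewrite /thermal_map.
have -> : tensmx (a *: X + Y) (gibbs T HB) =
    a *: tensmx X (gibbs T HB) + tensmx Y (gibbs T HB).
  by apply/matrixP => i j; rewrite !mxE mulrDl mulrA.
rewrite mulmxDr mulmxDl -scalemxAr -scalemxAl.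
apply/matrixP => i j; rewrite !mxE mulr_sumr -big_split /=.
by apply: eq_bigr => k _; rewrite !mxE.
Qed.

HB.instance Definition _ (R : realType) (n : nat) (T : \bar R) (m : nat)
    (HB : 'M[R[i]]_m) (U : 'M[R[i]]_(n * m)) :=
  GRing.isLinear.Build R[i] 'M[R[i]]_n 'M[R[i]]_n _ (thermal_map T HB U)
    (thermal_map_is_linear T HB U).

Definition superop (R : realType) (n : nat) :=
  {linear 'M[R[i]]_n -> 'M[R[i]]_n}.

(* lin_mx is the linear isomorphism from the linear maps on 'M_n onto
   'M_(n * n); the topology of the finite-dimensional space superop R n is the
   one transported along it. *)
Definition superop_closure (R : realType) (n : nat) (S : set (superop R n)) :
    set (superop R n) :=
  [set F : superop R n | closure [set lin_mx (G : _ -> _) | G in S] (lin_mx F)].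

Definition total_energy (R : realType) (n m : nat) (HS : 'M[R[i]]_n)
    (HB : 'M[R[i]]_m) : 'M[R[i]]_(n * m) :=
  tensmx HS (1%:M : 'M[R[i]]_m) + tensmx (1%:M : 'M[R[i]]_n) HB.

Definition TO (R : realType) (n : nat) (HS : 'M[R[i]]_n) (T : \bar R) :
    set (superop R n) :=
  [set F : superop R n | exists (m : nat) (HB : 'M[R[i]]_m) (U : 'M[R[i]]_(n * m)),
     [/\ (0 < m)%N, HB \is hermsymmx, U \is unitarymx,
         U *m total_energy HS HB *m U ^t* = total_energy HS HB
       & F =1 thermal_map T HB U]].

(* The levels are numbered from 1: block j : 'I_m carries energy (j + 1) dE. *)
Definition spin_bath (R : realType) (dE : R) (m : nat) (beta : 'I_m -> nat) :
    'M[R[i]]_(\sum_(j < m) beta j) :=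
  \mxdiag_(j < m) (((j.+1%:R * dE)%:C)%:M : 'M[R[i]]_(beta j)).

Definition spin_maps (R : realType) (n : nat) (HS : 'M[R[i]]_n) (dE : R)
    (T : \bar R) (admissible : forall m : nat, ('I_m -> nat) -> Prop) :
    set (superop R n) :=
  [set F : superop R n | exists (m : nat) (beta : 'I_m -> nat)
                  (Htot : 'M[R[i]]_(n * \sum_(j < m) beta j)),
     [/\ (0 < m)%N, admissible m beta, Htot \is hermsymmx,
         comm_mx Htot (total_energy HS (spin_bath dE beta))
       & F =1 thermal_map T (spin_bath dE beta) (expmx ('i%C *: Htot))]].

Definition TO_spin (R : realType) (n : nat) (HS : 'M[R[i]]_n) (dE : R)
    (T : \bar R) : set (superop R n) :=
  spin_maps HS dE T (fun m beta => forall j : 'I_m, (0 < beta j)%N).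

Definition TO_spin0 (R : realType) (n : nat) (HS : 'M[R[i]]_n) (dE : R)
    (T : \bar R) : set (superop R n) :=
  spin_maps HS dE T (fun m beta => (0 < \sum_(j < m) beta j)%N).

(* Main.v *)
Require Import Defs.
From HB Require Import structures.
From mathcomp Require Import all_boot all_order all_algebra.
From mathcomp Require Import complex mxtens.
From mathcomp Require Import all_classical all_reals all_analysis.
From mathcomp Require Import ring lra zify.

(* Diagonalise the bath Hamiltonian and cut U into n x n blocks W k h between
   bath levels. Energy conservation gives [HS, W k h] = (e h - e k) W k h, and
   the commutator with HS only has eigenvalues in dE Z; so U never links two
   bath levels whose gap is not a multiple of dE. Hence each class of levels
   modulo dE Z can be shifted rigidly to positive multiples of dE without
   breaking conservation. This spoils only the relative Gibbs weights of the
   classes, which are restored in the limit t -> oo by taking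
   floor (t * exp (- shift / T)) copies of each level. One further copy of every
   level, on which the unitary acts as the identity, makes all multiplicities
   positive; its total weight tends to 0. A unitary commuting with the total
   energy is exp (i H) with H commuting as well, by functional calculus. *)

Set Implicit Arguments.
Unset Strict Implicit.
Unset Printing Implicit Defensive.

Import Order.TTheory GRing.Theory Num.Theory numFieldNormedType.Exports.

Local Open Scope ring_scope.
Local Open Scope complex_scope.
Local Open Scope sesquilinear_scope.
Local Open Scope classical_set_scope.

(** * Exponential series *)

Lemma cvg_mx (T : topologicalType) m n (A : nat -> 'M[T]_(m, n))
    (B : 'M[T]_(m, n)) :
  (forall i j, A t i j @[t --> \oo] --> B i j) -> A @ \oo --> B.
Proof.
move=> AB P [Q BQ QP].
suff : \forall t \near \oo, forall i j, Q i j (A t i j).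
  by apply: filterS => t At; exact: QP.
apply: filter_forall => i; apply: filter_forall => j.
exact: (AB i j _ (BQ i j)).
Qed.

Lemma cvg_real_complex (R : realType) (x : nat -> R) (l : R) :
  x @ \oo --> l -> (x t)%:C @[t --> \oo] --> (l%:C : R[i]).
Proof.
(* Positivity of [e] in [R[i]] forces its imaginary part to be 0, so the radius is a real number. *)
move=> xl; apply/cvgrPdist_lt => e; case: e => a b; rewrite ltcE /= => /andP[/eqP -> a0].
move/cvgrPdist_lt: xl => /(_ _ a0); apply: filterS => t.
by rewrite -rmorphB /= normc_def /= expr0n /= addr0 sqrtr_sqr ltcR.
Qed.

(** Euler's form of exp (i h); [cvg_cis] ties it to the exponential series. *)
Definition cis (R : realType) (h : R) : R[i] := cos h +i* sin h.

Lemma cvg_expR_complex (R : realType) (x : R) :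
  series (fun k => (k`!%:R)^-1 * (x%:C : R[i]) ^+ k) @ \oo --> (expR x)%:C.
Proof.
have -> : series (fun k => (k`!%:R)^-1 * (x%:C : R[i]) ^+ k) =
    (fun t => (series (exp_coeff x) t)%:C).
  apply/funext => t; rewrite /series /= rmorph_sum /=; apply: eq_bigr => k _.
  by rewrite rmorphM fmorphV rmorphXn rmorph_nat mulrC.
apply: cvg_real_complex; exact: is_cvg_series_exp_coeff.
Qed.

Lemma cvg_cis (R : realType) (h : R) :
  series (fun k => (k`!%:R)^-1 * ('i%C * h%:C : R[i]) ^+ k) @ \oo --> cis h.
Proof.
have -> : series (fun k => (k`!%:R)^-1 * ('i%C * h%:C : R[i]) ^+ k) =
    (fun t => (series (cos_coeff h) t)%:C + 'i%C * (series (sin_coeff h) t)%:C).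
  apply/funext => t; rewrite /series /= !rmorph_sum /= mulr_sumr -big_split /=.
  apply: eq_bigr => k _; rewrite /cos_coeff /sin_coeff /=.
  rewrite exprMn !rmorphM !fmorphV !rmorphXn !rmorph_nat !rmorphN1.
  (* Even powers feed the cosine series and odd ones the sine series. The parity factors are those
     of [cos_coeff] and [sin_coeff], and they make the value of [k.-1] at 0 harmless. *)
  have -> : 'i%C ^+ k = (~~ odd k)%:R * (-1) ^+ k./2 +
      'i%C * ((odd k)%:R * (-1) ^+ k.-1./2) :> R[i].
    rewrite -{1}(odd_double_half k) exprD -mul2n exprM sqr_i.
    case: (odd k) (odd_double_half k) => /= [<-|_]; last by ring.
    by rewrite add1n /= uphalf_double half_double; ring.
  by ring.
have -> : cis h = (cos h)%:C + 'i%C * (sin h)%:C by rewrite [LHS]complexE.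
apply: cvgD; [|apply: cvgM; first exact: cvg_cst]; apply: cvg_real_complex.
  rewrite unlock; exact: is_cvg_series_cos_coeff.
rewrite unlock; exact: is_cvg_series_sin_coeff.
Qed.

(** [acos] takes values in [0, pi], where the sine is nonnegative, so the sign of the imaginary part
    decides between [acos a] and its opposite. *)
Lemma cis_surj (R : realType) (z : R[i]) : z * z^* = 1 -> exists h, z = cis h.
Proof.
case: z => a b; rewrite -sqr_normc -add_Re2_Im2 => -[/= ab].
have a1 : -1 <= a <= 1 by rewrite -ler_norml -(@ler_sqr _ _ 1) ?nnegrE// expr1n real_normK ?num_real//; nra.
have sb : Num.sqrt (1 - a ^+ 2) = `|b| by rewrite -sqrtr_sqr; congr Num.sqrt; lra.
have [b0|b0] := leP 0 b.
  by exists (acos a); rewrite /cis acosK ?in_itv//= sin_acos// sb ger0_norm.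
exists (- acos a); rewrite /cis cosN sinN acosK ?in_itv//= sin_acos// sb.
by rewrite ltr0_norm ?opprK.
Qed.

(** * Unitary conjugation and matrix exponentials *)

Lemma cvg_sumr (K : numFieldType) (V : normedModType K) (I : finType)
    (f : I -> nat -> V) (l : I -> V) :
  (forall i, f i @ \oo --> l i) ->
  \sum_i f i t @[t --> \oo] --> \sum_i l i.
Proof.
move=> fl; elim: (index_enum I) => [|i s IH].
  by rewrite big_nil; under eq_fun do rewrite big_nil; exact: cvg_cst.
by rewrite big_cons; under eq_fun do rewrite big_cons; exact: cvgD.
Qed.

Lemma mulmx_diag_mulmxE (R : realType) p (A B : 'M[R[i]]_p) (d : 'rV[R[i]]_p) i j :
  (A *m diag_mx d *m B) i j = \sum_k A i k * d 0 k * B k j.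
Proof. by rewrite mxE; apply: eq_bigr => k _; rewrite mul_mx_diag mxE. Qed.

Section unitary.
Variables (C : numClosedFieldType) (p : nat) (V : 'M[C]_p).
Hypothesis Vu : V \is unitarymx.

Lemma unitarymx_mulmxV : V *m V^t* = 1%:M. Proof. exact/unitarymxP. Qed.

Lemma unitarymx_mulVmx : V^t* *m V = 1%:M.
Proof. by rewrite -invmx_unitary// mulVmx// unitarymx_unit. Qed.

Lemma unitary_conj_mul (A B : 'M[C]_p) :
  (V^t* *m A *m V) *m (V^t* *m B *m V) = V^t* *m (A *m B) *m V.
Proof. by rewrite !mulmxA -(mulmxA _ V) unitarymx_mulmxV mulmx1. Qed.

Lemma unitary_conj_exp (A : 'M[C]_p) k :
  (V^t* *m A *m V) ^+ k = V^t* *m (A ^+ k) *m V.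
Proof.
elim: k => [|k IH]; first by rewrite !expr0 mulmx1 unitarymx_mulVmx.
by rewrite !exprS IH; exact: unitary_conj_mul.
Qed.

Lemma unitary_conjK (A : 'M[C]_p) : V *m (V^t* *m A *m V) *m V^t* = A.
Proof.
by rewrite !mulmxA unitarymx_mulmxV mul1mx -mulmxA unitarymx_mulmxV mulmx1.
Qed.

Lemma unitary_conjVK (A : 'M[C]_p) : V^t* *m (V *m A *m V^t*) *m V = A.
Proof.
by rewrite !mulmxA unitarymx_mulVmx mul1mx -mulmxA unitarymx_mulVmx mulmx1.
Qed.

Lemma mxtrace_unitary_conj (A : 'M[C]_p) : \tr (V^t* *m A *m V) = \tr A.
Proof. by rewrite mxtrace_mulC mulmxA unitarymx_mulmxV mul1mx. Qed.

Lemma unitary_conj_adj (A : 'M[C]_p) : (V^t* *m A *m V)^t* = V^t* *m A^t* *m V.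
Proof. by rewrite !trmx_mul !map_mxM trmxCK mulmxA. Qed.

Lemma unitary_commP (A : 'M[C]_p) : V *m A *m V^t* = A <-> comm_mx V A.
Proof.
split=> [VA|cVA]; first by rewrite /comm_mx -[in RHS]VA -mulmxA unitarymx_mulVmx mulmx1.
by rewrite cVA -mulmxA unitarymx_mulmxV mulmx1.
Qed.

Lemma unitary_conj_comm (A B : 'M[C]_p) :
  comm_mx A (V^t* *m B *m V) -> comm_mx (V *m A *m V^t*) B.
Proof.
move=> /(congr1 (fun M => V *m M *m V^t*)).
by rewrite -{1 2}[A]unitary_conjVK !unitary_conj_mul !unitary_conjK.
Qed.

Lemma conj_unitary_conj (U A : 'M[C]_p) (U' := V *m U *m V^t*) :
  U *m (V^t* *m A *m V) *m U^t* = V^t* *m (U' *m A *m U'^t*) *m V.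
Proof.
by rewrite -{1 2}(unitary_conjVK U) unitary_conj_adj !unitary_conj_mul.
Qed.

Lemma unitary_conj_unitary (A : 'M[C]_p) :
  A \is unitarymx -> V *m A *m V^t* \is unitarymx.
Proof.
by move=> Au; apply: mul_unitarymx; [exact: mul_unitarymx|rewrite trmxC_unitary].
Qed.

Lemma unitary_conjV_unitary (A : 'M[C]_p) :
  A \is unitarymx -> V^t* *m A *m V \is unitarymx.
Proof.
by move=> Au; apply: mul_unitarymx => //; apply: mul_unitarymx; rewrite ?trmxC_unitary.
Qed.

(** In the eigenbasis, commuting with [diag_mx d] means that the entry (i, j) vanishes unless
    [d 0 i = d 0 j]; this passes to every [d'] that is a function of [d]. *)
Lemma comm_mx_diag (A : 'M[C]_p) (d d' : 'rV[C]_p) :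
  (forall i j, d 0 i = d 0 j -> d' 0 i = d' 0 j) ->
  comm_mx A (V^t* *m diag_mx d *m V) -> comm_mx A (V^t* *m diag_mx d' *m V).
Proof.
move=> dd' cA.
suff : comm_mx (V *m A *m V^t*) (diag_mx d').
  move=> /(congr1 (fun M => V^t* *m M *m V)); rewrite -(unitary_conj_mul _ (diag_mx d')).
  by rewrite -(unitary_conj_mul (diag_mx d')) unitary_conjVK.
have := unitary_conj_comm cA.
move: (V *m A *m V^t*) => M /matrixP cM; apply/matrixP => i j.
move: (cM i j); rewrite !mul_mx_diag !mul_diag_mx !mxE.
have [->|M0] := eqVneq (M i j) 0; first by rewrite !(mul0r, mulr0).
rewrite [d 0 i * _]mulrC => /(mulfI M0) /esym/dd' ->; exact: mulrC.
Qed.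

End unitary.

Lemma normal_spectral (C : numClosedFieldType) p (A : 'M[C]_p) :
  A \is normalmx -> exists2 V : 'M[C]_p, V \is unitarymx &
    exists d, A = V^t* *m diag_mx d *m V.
Proof.
move=> /orthomx_spectralP; rewrite invmx_unitary ?spectral_unitarymx// => ->.
by exists (spectralmx A); [exact: spectral_unitarymx|exists (spectral_diag A)].
Qed.

Lemma herm_spectral (R : realType) p (A : 'M[R[i]]_p) :
  A \is hermsymmx -> exists2 V : 'M[R[i]]_p, V \is unitarymx &
    exists e : 'I_p -> R, A = V^t* *m diag_mx (\row_k (e k)%:C) *m V.
Proof.
move=> hA; have /orthomx_spectralP := hermitian_normalmx hA.
have /mxOverP sr := hermitian_spectral_diag_real hA.
rewrite invmx_unitary ?spectral_unitarymx// => ->.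
exists (spectralmx A); first exact: spectral_unitarymx.
exists (fun k => complex.Re (spectral_diag A 0 k)).
suff <- : spectral_diag A = \row_k (complex.Re (spectral_diag A 0 k))%:C by [].
by apply/rowP => k; rewrite mxE RRe_real.
Qed.

Lemma spectral_herm (R : realType) p (V : 'M[R[i]]_p) (e : 'I_p -> R) :
  V^t* *m diag_mx (\row_k (e k)%:C) *m V \is hermsymmx.
Proof.
rewrite is_hermitianmxE expr0 scale1r unitary_conj_adj tr_diag_mx map_diag_mx.
apply/eqP; congr (_ *m diag_mx _ *m _); apply/rowP => k; rewrite !mxE.
exact/esym/conjc_real.
Qed.

(** Powers act on each eigenvalue separately, so every entry of a partial sum is a finite
    combination of scalar series. The limits [w] stay abstract to serve both Gibbs states and
    unitaries. *)
Lemma expmx_spectral (R : realType) p (V : 'M[R[i]]_p) (z w : 'rV[R[i]]_p) :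
  V \is unitarymx ->
  (forall i, series (fun k => (k`!%:R)^-1 * z 0 i ^+ k) @ \oo --> w 0 i) ->
  expmx (V^t* *m diag_mx z *m V) = V^t* *m diag_mx w *m V.
Proof.
move=> Vu zw; apply: cvg_lim => //; apply: cvg_mx => i j.
have -> : (fun t => series (fun k => (k`!%:R)^-1 *:
      (V^t* *m diag_mx z *m V) ^+ k) t i j) =
    (fun t => \sum_l V^t* i l * series (fun k => (k`!%:R)^-1 * z 0 l ^+ k) t * V l j).
  apply/funext => t; rewrite /series /= summxE.
  under [RHS]eq_bigr do rewrite mulr_sumr mulr_suml.
  rewrite exchange_big /=; apply: eq_bigr => k _.
  have diagX : diag_mx z ^+ k = diag_mx (\row_l z 0 l ^+ k).
    elim: k => [|k IH]; first by apply/matrixP => a b; rewrite !mxE.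
    rewrite exprS IH -[LHS]/(_ *m _); apply/matrixP => a b.
    by rewrite mul_diag_mx !mxE mulrnAr exprS.
  rewrite unitary_conj_exp// diagX mxE mulmx_diag_mulmxE mulr_sumr.
  by apply: eq_bigr => l _; rewrite !mxE; ring.
rewrite mulmx_diag_mulmxE.
apply: cvg_sumr => l; apply: cvgM; last exact: cvg_cst.
by apply: cvgM; [exact: cvg_cst|exact: zw].
Qed.

Lemma expmx_herm (R : realType) p (V : 'M[R[i]]_p) (e : 'I_p -> R) :
  V \is unitarymx ->
  expmx ('i%C *: (V^t* *m diag_mx (\row_k (e k)%:C) *m V)) =
    V^t* *m diag_mx (\row_k cis (e k)) *m V.
Proof.
move=> Vu; rewrite scalemxAl scalemxAr -linearZ/=; apply: expmx_spectral => // k.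
by rewrite !mxE; exact: cvg_cis.
Qed.

Lemma cis_diag_unitary (R : realType) p (e : 'I_p -> R) :
  diag_mx (\row_k cis (e k)) \is unitarymx.
Proof.
apply/unitarymxP/matrixP => i j.
rewrite tr_diag_mx map_diag_mx mul_diag_mx !mxE mulrnAr -normCK -add_Re2_Im2 /=.
by rewrite cos2Dsin2.
Qed.

(* As in gibbs, every value of T that is not finite is treated as +oo. *)
Definition inv_temp (R : realType) (T : \bar R) : R :=
  if T is t%:E then t^-1 else 0.

Definition boltzmann (R : realType) (T : \bar R) (x : R) : R :=
  expR (- inv_temp T * x).

Lemma gibbs_spectral (R : realType) (T : \bar R) p (V : 'M[R[i]]_p) (e : 'I_p -> R) :
  V \is unitarymx ->
  gibbs T (V^t* *m diag_mx (\row_k (e k)%:C) *m V) =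
  V^t* *m diag_mx (\row_k (boltzmann T (e k) / \sum_l boltzmann T (e l))%:C) *m V.
Proof.
move=> Vu; have diagE : diag_mx (\row_k (boltzmann T (e k) / \sum_l boltzmann T (e l))%:C) =
   ((\sum_l boltzmann T (e l))^-1)%:C *: diag_mx (\row_k (boltzmann T (e k))%:C).
  by rewrite -linearZ/=; congr diag_mx; apply/rowP => k; rewrite !mxE mulrC rmorphM.
rewrite diagE -scalemxAr -scalemxAl.
(* With inverse temperature 0 every weight is 1 and the weights sum to [p]. The same equation
   settles -oo by conversion. *)
have gibbsoo : (p%:R)^-1 *: 1%:M = ((\sum_(l < p) boltzmann +oo (e l))^-1)%:C *:
    (V^t* *m diag_mx (\row_k (boltzmann +oo (e k))%:C) *m V).
  have b1 x : boltzmann +oo x = 1 :> R by rewrite /boltzmann oppr0 mul0r expR0.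
  under eq_bigr do rewrite b1.
  rewrite sumr_const card_ord fmorphV rmorph_nat; congr (_ *: _).
  rewrite (_ : \row_k _ = const_mx 1) ?diag_const_mx ?mulmx1 ?unitarymx_mulVmx//.
  by apply/rowP => k; rewrite !mxE b1.
case: T diagE => [t| |] _; [|exact: gibbsoo|exact: gibbsoo].
rewrite /gibbs.
have -> : expmx (- (t^-1)%:C *: (V^t* *m diag_mx (\row_k (e k)%:C) *m V)) =
    V^t* *m diag_mx (\row_k (boltzmann t%:E (e k))%:C) *m V.
  rewrite scalemxAl scalemxAr -linearZ/=; apply: expmx_spectral => // k; rewrite !mxE -rmorphN -rmorphM.
  exact: cvg_expR_complex.
have trE : \tr (V^t* *m diag_mx (\row_k (boltzmann t%:E (e k))%:C) *m V) =
    (\sum_l boltzmann t%:E (e l))%:C.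
  rewrite mxtrace_unitary_conj// mxtrace_diag rmorph_sum.
  by apply: eq_bigr => k _; rewrite mxE.
rewrite trE -fmorphV; reflexivity.
Qed.

(** * Blocks over the bath levels *)

Section blocks.
Variables (R : realType) (n m : nat).
Implicit Types (A B : 'M[R[i]]_(n * m)).

(** The system operator <k| A |h> between two bath basis vectors. *)
Definition blk A (k h : 'I_m) : 'M[R[i]]_n :=
  \matrix_(i, j) A (mxtens_index (i, k)) (mxtens_index (j, h)).

Definition unblk (W : 'I_m -> 'I_m -> 'M[R[i]]_n) : 'M[R[i]]_(n * m) :=
  \matrix_(p, q) W (mxtens_unindex p).2 (mxtens_unindex q).2
                   (mxtens_unindex p).1 (mxtens_unindex q).1.

Lemma unblkK W : blk (unblk W) = W.
Proof.
apply/funext => k; apply/funext => h; apply/matrixP => i j.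
by rewrite !mxE !mxtens_indexK.
Qed.

Lemma blkP A B : (forall k h, blk A k h = blk B k h) -> A = B.
Proof.
move=> AB; apply/matrixP => p q.
case: (mxtens_indexP p) (mxtens_indexP q) => i k [j h].
by have /matrixP /(_ i j) := AB k h; rewrite !mxE.
Qed.

Lemma blkM A B k h : blk (A *m B) k h = \sum_l blk A k l *m blk B l h.
Proof.
apply/matrixP => i j; rewrite summxE !mxE.
rewrite (reindex (@mxtens_index n m)) /=; last first.
  by exists (@mxtens_unindex n m) => p _; rewrite ?mxtens_indexK ?mxtens_unindexK.
transitivity (\sum_a \sum_l blk A k l i a * blk B l h a j).
  by rewrite pair_bigA; apply: eq_bigr => -[a l] _; rewrite !mxE.
by rewrite exchange_big; apply: eq_bigr => l _; rewrite mxE.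
Qed.

Lemma blkD A B k h : blk (A + B) k h = blk A k h + blk B k h.
Proof. by apply/matrixP => i j; rewrite !mxE. Qed.

Lemma blk_adj A k h : blk (A^t*) k h = (blk A h k)^t*.
Proof. by apply/matrixP => i j; rewrite !mxE. Qed.

Lemma blk_tens (X : 'M[R[i]]_n) (D : 'M[R[i]]_m) k h : blk (tensmx X D) k h = D k h *: X.
Proof. by apply/matrixP => i j; rewrite !mxE !mxtens_indexK mulrC. Qed.

Lemma blk1 k h : blk 1%:M k h = (k == h)%:R%:M.
Proof.
apply/matrixP => i j; rewrite !mxE (inj_eq (can_inj (@mxtens_indexK n m))).
by rewrite xpair_eqE; case: (i == j); case: (k == h).
Qed.

End blocks.

Lemma ptraceBE (R : realType) n m (A : 'M[R[i]]_(n * m)) :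
  ptraceB A = \sum_k blk A k k.
Proof.
apply/matrixP => i j; rewrite summxE !mxE.
by apply: eq_bigr => k _; rewrite !mxE.
Qed.

Lemma tens1mx1 (R : realType) n m :
  tensmx (1%:M : 'M[R[i]]_n) (1%:M : 'M[R[i]]_m) = 1%:M.
Proof.
by apply: blkP => k h; rewrite blk_tens blk1 mxE scale_scalar_mx mulr1.
Qed.

Lemma tensmx_adj (R : realType) n m (A : 'M[R[i]]_n) (B : 'M[R[i]]_m) :
  (tensmx A B)^t* = tensmx (A^t*) (B^t*).
Proof. by rewrite trmx_tens map_mxT. Qed.

Lemma tens1mx_unitary (R : realType) n m (V : 'M[R[i]]_m) :
  V \is unitarymx -> tensmx (1%:M : 'M[R[i]]_n) V \is unitarymx.
Proof.
move=> /unitarymxP VV; apply/unitarymxP.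
by rewrite tensmx_adj tensmx_mul VV trmx1 map_mx1 mulmx1 tens1mx1.
Qed.

Lemma tensmx_conj (R : realType) n m (V : 'M[R[i]]_m) (X : 'M[R[i]]_n)
    (D : 'M[R[i]]_m) :
  tensmx X (V^t* *m D *m V) =
  (tensmx (1%:M : 'M[R[i]]_n) V)^t* *m tensmx X D *m tensmx (1%:M : 'M[R[i]]_n) V.
Proof.
by rewrite tensmx_adj !tensmx_mul trmx1 map_mx1 mul1mx mulmx1.
Qed.

(** [V] acts on the blocks by scalars only, and the sum over the traced index turns these scalars
    into entries of the identity [V *m V^t*]. *)
Lemma ptraceB_conj (R : realType) n m (V : 'M[R[i]]_m) (A : 'M[R[i]]_(n * m)) :
  V \is unitarymx ->
  ptraceB ((tensmx (1%:M : 'M[R[i]]_n) V)^t* *m A *m tensmx (1%:M : 'M[R[i]]_n) V)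
  = ptraceB A.
Proof.
move=> Vu; rewrite !ptraceBE tensmx_adj trmx1 map_mx1.
have E k : blk (tensmx 1%:M (V^t*) *m A *m tensmx 1%:M V) k k =
    \sum_h \sum_l (V^t* k l * V h k) *: blk A l h.
  rewrite blkM; apply: eq_bigr => h' _; rewrite blkM mulmx_suml.
  apply: eq_bigr => l' _; rewrite !blk_tens.
  by rewrite -scalemxAl mul1mx -scalemxAr mulmx1 scalerA mulrC.
under eq_bigr => k _ do rewrite E.
have VV h l : \sum_k V^t* k l * V h k = (h == l)%:R.
  have /matrixP/(_ h l) := unitarymx_mulmxV Vu; rewrite !mxE => <-.
  by apply: eq_bigr => k _; rewrite mulrC.
rewrite exchange_big; apply: eq_bigr => h _.
rewrite exchange_big (bigD1 h)//= -scaler_suml VV big1 ?addr0 => [|l lh].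
  by rewrite eqxx scale1r.
by rewrite -scaler_suml VV eq_sym (negbTE lh) scale0r.
Qed.

(* The thermal map in block form: only the blocks of U, the bath energies and
   T enter, so the levels may be indexed by any finite type. *)
Definition bath_map (R : realType) (T : \bar R) n (K : finType) (e : K -> R)
    (W : K -> K -> 'M[R[i]]_n) (X : 'M[R[i]]_n) : 'M[R[i]]_n :=
  \sum_h (boltzmann T (e h) / \sum_l boltzmann T (e l))%:C *:
    \sum_k W k h *m X *m (W k h)^t*.

(** In the eigenbasis of the bath the Gibbs state is diagonal, which leaves a Kraus form: the block
    from level h to level k is weighted by the Gibbs probability of h. *)
Lemma thermal_map_spectral (R : realType) n (T : \bar R) m (V : 'M[R[i]]_m)
    (e : 'I_m -> R) (U : 'M[R[i]]_(n * m)) X (Q := tensmx (1%:M : 'M[R[i]]_n) V) :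
  V \is unitarymx ->
  thermal_map T (V^t* *m diag_mx (\row_k (e k)%:C) *m V) U X =
  bath_map T e (blk (Q *m U *m Q^t*)) X.
Proof.
move=> Vu; have Qu : Q \is unitarymx := tens1mx_unitary n Vu.
rewrite /thermal_map gibbs_spectral// tensmx_conj -/Q.
set g := \row_k _; pose U' := Q *m U *m Q^t*.
rewrite (conj_unitary_conj Qu) -/U'.
rewrite ptraceB_conj// ptraceBE /bath_map.
transitivity (\sum_k \sum_h g 0 h *: (blk U' k h *m X *m (blk U' k h)^t*)).
  apply: eq_bigr => k _; rewrite blkM; apply: eq_bigr => h _.
  rewrite blk_adj blkM (bigD1 h)//= big1 ?addr0 => [|l lh].
    by rewrite blk_tens mxE eqxx mulr1n -scalemxAr -scalemxAl.
  by rewrite blk_tens mxE (negbTE lh) mulr0n scale0r mulmx0.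
rewrite exchange_big; apply: eq_bigr => h _; rewrite scaler_sumr.
by apply: eq_bigr => k _; rewrite mxE.
Qed.

(* W is the block matrix of a unitary commuting with HS (x) 1 + 1 (x) diag e. *)
Definition energy_blocks (R : realType) n (HS : 'M[R[i]]_n) (K : finType)
    (e : K -> R) (W : K -> K -> 'M[R[i]]_n) : Prop :=
  (forall k h, \sum_l W k l *m (W h l)^t* = (k == h)%:R%:M) /\
  (forall k h, HS *m W k h - W k h *m HS = (e h - e k)%:C *: W k h).

(** The diagonal bath energy scales block column h by [e h] and block row k by [e k], so
    conservation becomes an eigenvalue equation for the commutator with [HS]. *)
Lemma energy_blocksP (R : realType) n (HS : 'M[R[i]]_n) m (e : 'I_m -> R)
    (U : 'M[R[i]]_(n * m)) :
  energy_blocks HS e (blk U) <->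
  U \is unitarymx /\ comm_mx U (total_energy HS (diag_mx (\row_k (e k)%:C))).
Proof.
have commE k h : (HS *m blk U k h - blk U k h *m HS = (e h - e k)%:C *: blk U k h)
    <-> blk (U *m total_energy HS (diag_mx (\row_k (e k)%:C))) k h =
        blk (total_energy HS (diag_mx (\row_k (e k)%:C)) *m U) k h.
  rewrite !blkM (bigD1 h)//= big1 ?addr0 => [|l lh]; last first.
    by rewrite blkD !blk_tens !mxE (negbTE lh) mulr0n !scale0r addr0 mulmx0.
  rewrite (bigD1 k)//= big1 ?addr0 => [|l lh]; last first.
    by rewrite blkD !blk_tens !mxE eq_sym (negbTE lh) mulr0n !scale0r addr0 mul0mx.
  rewrite !blkD !blk_tens !mxE !eqxx !mulr1n !scale1r mulmxDr mulmxDl.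
  rewrite -scalemxAr -scalemxAl mulmx1 mul1mx rmorphB scalerBl.
  set x := HS *m _; set y := _ *m HS; set a := _ *: _; set b := _ *: _.
  have xyab : (x - y == a - b) = (y + a == x + b).
    by move: x y a b => x y a b; rewrite subr_eq addrAC eq_sym subr_eq addrC.
  by split=> /eqP H; apply/eqP; move: H; rewrite xyab.
split=> [[Wu Wc]|[/unitarymxP Uu Uc]].
  split; first apply/unitarymxP; apply: blkP => k h; last by apply/commE.
  by rewrite blkM blk1 -Wu; apply: eq_bigr => l _; rewrite blk_adj.
split=> k h; last by apply/commE; rewrite Uc.
by rewrite -blk1 -Uu blkM; apply: eq_bigr => l _; rewrite blk_adj.
Qed.

(** * Thermal operations, block families and spin baths *)

Lemma TO_bath_map (R : realType) n (HS : 'M[R[i]]_n) (T : \bar R)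
    (F : superop R n) :
  TO HS T F -> exists m (e : 'I_m -> R) (W : 'I_m -> 'I_m -> 'M[R[i]]_n),
    [/\ (0 < m)%N, energy_blocks HS e W & F =1 bath_map T e W].
Proof.
move=> [m [HB [U [m0 hHB Uu Uc FE]]]].
have [V Vu [e HBE]] := herm_spectral hHB.
have Qu := tens1mx_unitary n Vu; set Q := tensmx _ V in Qu.
exists m, e, (blk (Q *m U *m Q^t*)); split=> //; last first.
  by move=> X; rewrite FE HBE thermal_map_spectral.
apply/energy_blocksP; split; first by apply: (unitary_conj_unitary Qu Uu).
(* Rotating the diagonal bath back with [Q] restores the original total energy, which [U]
   conserves. *)
apply: (unitary_conj_comm Qu); rewrite (_ : _ *m Q = total_energy HS HB).
  exact/(unitary_commP Uu).
rewrite /total_energy HBE tensmx_conj mulmxDr mulmxDl; congr (_ + _).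
by rewrite -tensmx_conj mulmx1 unitarymx_mulVmx.
Qed.

Lemma unitary_log (R : realType) p (U E : 'M[R[i]]_p) :
  U \is unitarymx -> comm_mx U E ->
  exists H : 'M[R[i]]_p,
    [/\ H \is hermsymmx, comm_mx H E & expmx ('i%C *: H) = U].
Proof.
move=> Uu cUE.
have Un : U \is normalmx.
  by apply/normalmxP; rewrite unitarymx_mulmxV// unitarymx_mulVmx.
have [V Vu [u UE]] := normal_spectral Un.
have u1 k : u 0 k * (u 0 k)^* = 1.
  have := unitary_conj_unitary Vu Uu; rewrite UE (unitary_conjK Vu).
  move=> /unitarymxP; rewrite tr_diag_mx map_diag_mx => /matrixP/(_ k k).
  by rewrite mul_diag_mx !mxE eqxx !mulr1n.
(* The phase is a function of the eigenvalue, so equal eigenvalues get equal phases, as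
   [comm_mx_diag] requires. The default 0 is never taken on the spectrum, where the modulus is 1. *)
pose lg z : R := xget 0 [set h | z = cis h].
have lgK k : cis (lg (u 0 k)) = u 0 k.
  by have [h uh] := cis_surj (u1 k); exact/esym/(@xgetPex _ 0 [set h | u 0 k = cis h])/(ex_intro _ h).
exists (V^t* *m diag_mx (\row_k (lg (u 0 k))%:C) *m V); split.
- exact: spectral_herm.
- apply/esym/(comm_mx_diag Vu (d := u)); last by rewrite -UE.
  by move=> i j; rewrite !mxE => ->.
- rewrite expmx_herm// [RHS]UE; suff <- : u = \row_k cis (lg (u 0 k)) by reflexivity.
  by apply/rowP => k; rewrite mxE lgK.
Qed.

Lemma spin_bathE (R : realType) (dE : R) m (beta : 'I_m -> nat) :
  spin_bath dE beta = diag_mx (\row_s ((tagnat.sig1 s).+1%:R * dE)%:C).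
Proof.
rewrite /spin_bath.
under eq_mxdiag do rewrite -diag_const_mx.
by rewrite -diag_mxrow; congr diag_mx; apply/rowP => s; rewrite !mxE.
Qed.

(** A function of [H] commutes with all that commutes with [H], so exp (i H) conserves the total
    energy; it is unitary because its eigenvalues are phases. *)
Lemma TO_spin0_sub_TO (R : realType) n (HS : 'M[R[i]]_n) (dE : R) T :
  TO_spin0 HS dE T `<=` TO HS T.
Proof.
move=> F [m [beta [H [m0 b0 hH cH FE]]]].
exists (\sum_(j < m) beta j)%N, (spin_bath dE beta), (expmx ('i%C *: H)).
have [V Vu [h HE]] := herm_spectral hH.
have Uu : expmx ('i%C *: H) \is unitarymx.
  rewrite HE (expmx_herm h Vu).
  by apply: (unitary_conjV_unitary Vu); apply: cis_diag_unitary.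
split.
- by [].
(* The spin bath is already diagonal, so the identity serves as its eigenbasis. *)
- rewrite spin_bathE (_ : diag_mx _ = 1%:M^t* *m diag_mx
    (\row_s ((tagnat.sig1 s).+1%:R * dE)%:C) *m 1%:M).
    exact: spectral_herm.
  by rewrite trmx1 map_mx1 mul1mx mulmx1.
- by [].
- apply/(unitary_commP Uu).
  rewrite HE expmx_herm//; apply/esym.
  apply: (comm_mx_diag Vu (d := \row_k (h k)%:C)); last by rewrite -HE.
  by move=> i j; rewrite !mxE => -[->].
- exact: FE.
Qed.

Lemma reindex_blocks (R : realType) n (HS : 'M[R[i]]_n) (T : \bar R)
   (K L : finType) (e : K -> R) (W : K -> K -> 'M[R[i]]_n) (f : L -> K) :
  bijective f -> energy_blocks HS e W ->
  energy_blocks HS (e \o f) (fun k h => W (f k) (f h)) /\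
  bath_map T (e \o f) (fun k h => W (f k) (f h)) = bath_map T e W.
Proof.
move=> fb [Wu Wc]; have fo : {on [pred _ | true], bijective f} by exact: onW_bij.
split; [split=> [k h|k h]|].
- by rewrite -(inj_eq (bij_inj fb)) -Wu [RHS](reindex f).
- exact: Wc.
apply/funext => X; rewrite /bath_map [RHS](reindex f)//=.
apply: eq_bigr => h _; rewrite [in RHS](reindex f)//=.
by congr (_ *: _); rewrite [in RHS](reindex f).
Qed.

(** Sorts the elements of [K] by [lev]: block j enumerates the fibre over j, and [beta j] is the
    size of that fibre. *)
Lemma level_bijection (K : finType) m (lev : K -> 'I_m) :
  exists (beta : 'I_m -> nat) (f : 'I_(\sum_(j < m) beta j) -> K),
    bijective f /\ forall s, lev (f s) = tagnat.sig1 s.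
Proof.
pose beta j := #|[pred k | lev k == j]|.
pose f (s : 'I_(\sum_(j < m) beta j)) : K :=
  enum_val (tagnat.sig2 s : 'I_#|[pred k | lev k == tagnat.sig1 s]|).
have fl s : lev (f s) = tagnat.sig1 s.
  by have := enum_valP (tagnat.sig2 s : 'I_#|[pred k | lev k == tagnat.sig1 s]|);
    rewrite inE => /eqP.
exists beta, f; split=> //; apply: inj_card_bij.
  move=> s t fst; have st : tagnat.sig1 s = tagnat.sig1 t by rewrite -!fl fst.
  (* An index is recovered from its block and its position there; positions are generalised first
     because their types depend on the block. *)
  rewrite -(tagnat.sig2K s) -(tagnat.sig2K t).
  move: fst; rewrite /f; move: (tagnat.sig2 s) (tagnat.sig2 t); rewrite st.
  by move=> a b /enum_val_inj ->.
rewrite card_ord -sum1_card (partition_big lev predT)//=.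
by apply: leq_sum => j _; rewrite sum1_card.
Qed.

(** Sorting the levels gives the multiplicities and [unitary_log] gives the Hamiltonian.
    Surjectivity of [lev] is what makes all multiplicities positive. *)
Lemma bath_map_spin (R : realType) n (HS : 'M[R[i]]_n) (dE : R) (T : \bar R)
    m (K : finType) (lev : K -> 'I_m) (W : K -> K -> 'M[R[i]]_n) :
  (0 < m)%N -> (forall j, exists k, lev k = j) ->
  energy_blocks HS (fun k => (lev k).+1%:R * dE) W ->
  exists2 G, TO_spin HS dE T G & G =1 bath_map T (fun k => (lev k).+1%:R * dE) W.
Proof.
move=> m0 levs We; have [beta [f [fb fl]]] := level_bijection lev.
have [We' WE] := reindex_blocks T fb We.
set W' := fun k h => W (f k) (f h) in We' WE.
have eE : (fun k => (lev k).+1%:R * dE) \o f = fun s => (tagnat.sig1 s).+1%:R * dE.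
  by apply/funext => s /=; rewrite fl.
rewrite eE in We' WE; rewrite -WE.
have [Uu Uc] : unblk W' \is unitarymx /\ comm_mx (unblk W')
    (total_energy HS (spin_bath dE beta)).
  by rewrite spin_bathE; apply/energy_blocksP; rewrite unblkK.
have [H [hH cH HE]] := unitary_log Uu Uc.
exists (thermal_map T (spin_bath dE beta) (expmx ('i%C *: H))).
  exists m, beta, H; split=> // j; have [k <-] := levs j; have [g _ gK] := fb.
  (* [tagnat.sig2] is an ordinal below the multiplicity of its block, which is therefore
     positive. *)
  by rewrite -(gK k) fl; case: (tagnat.sig2 (g k)) => a; exact: leq_ltn_trans.
move=> X; rewrite /= HE.
have I1 : (1%:M : 'M[R[i]]_(\sum_(j < m) beta j)) \is unitarymx.
  by apply/unitarymxP; rewrite trmx1 map_mx1 mulmx1.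
have := thermal_map_spectral T (fun s => (tagnat.sig1 s).+1%:R * dE) (unblk W') X I1.
rewrite tens1mx1 !trmx1 !map_mx1 !mul1mx !mulmx1 unblkK => <-.
by rewrite spin_bathE.
Qed.

(** * Approximation by spin baths *)

(** In the eigenbasis of [HS], a nonzero entry (i, j) of [W] forces [d = l i - l j], and [E1]
    cancels in this difference. *)
Lemma energy_gap (R : realType) n (HS : 'M[R[i]]_n) (E1 dE : R)
    (W : 'M[R[i]]_n) (d : R) :
  HS \is hermsymmx ->
  (forall a : R[i], eigenvalue HS a -> exists j : nat, a = (E1 + j%:R * dE)%:C) ->
  W != 0 -> HS *m W - W *m HS = d%:C *: W ->
  exists z : int, d = z%:~R * dE.
Proof.
move=> hHS spec W0 HW; have [V Vu [l HSE]] := herm_spectral hHS.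
(* [eigenvalue] concerns row vectors: row i of [V] is a left eigenvector of [HS] for [l i], nonzero
   because [V] is unitary. *)
have eigl i : exists j : nat, l i = E1 + j%:R * dE.
  have [|j /complexI ?] := spec (l i)%:C; last by exists j.
  apply/eigenvalueP; exists (row i V).
    rewrite HSE -row_mul !mulmxA (unitarymx_mulmxV Vu) mul1mx row_mul.
    by apply/rowP => k; rewrite -row_mul mxE mul_diag_mx !mxE.
  apply/eqP => /(congr1 (fun v => (v *m V^t*) 0 i)) /eqP.
  by rewrite -row_mul (unitarymx_mulmxV Vu) mul0mx !mxE eqxx oner_eq0.
have {}HW : diag_mx (\row_k (l k)%:C) *m (V *m W *m V^t*) -
    (V *m W *m V^t*) *m diag_mx (\row_k (l k)%:C) = d%:C *: (V *m W *m V^t*).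
  rewrite scalemxAl scalemxAr -HW HSE mulmxBr mulmxBl !mulmxA.
  rewrite (unitarymx_mulmxV Vu) mul1mx; congr (_ - _).
  by rewrite -!mulmxA (unitarymx_mulmxV Vu) mulmx1.
have M0 : V *m W *m V^t* != 0.
  apply: contra_neq W0 => M0.
  by rewrite -(unitary_conjVK Vu W) M0 mulmx0 mul0mx.
move: (V *m W *m V^t*) M0 HW => M /eqP M0.
rewrite mul_mx_diag mul_diag_mx => /matrixP HW.
have [i [j Mij]] : exists i j, M i j != 0.
  apply: contrapT => M00; apply: M0; apply/matrixP => i j; rewrite mxE.
  by apply/eqP; apply: contrapT => Mij; apply: M00; exists i, j; apply/negP.
have := HW i j; rewrite !mxE [M i j * _]mulrC -mulrBl.
move=> /(mulIf Mij); rewrite -rmorphB => /complexI <-.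
have [a ->] := eigl i; have [b ->] := eigl j.
by exists (a%:Z - b%:Z); rewrite rmorphB /= !pmulrn; ring.
Qed.

(** If two energies differ by [z * dE], the floors of their quotients by [dE] differ by exactly [z],
    so rounding shifts both energies equally. *)
Lemma lattice_shift (R : realType) (K : finType) (e : K -> R) (dE : R) :
  0 < dE -> exists m (lev : K -> 'I_m.+1), forall k h,
    (exists z : int, e h - e k = z%:~R * dE) ->
    e k - (lev k).+1%:R * dE = e h - (lev h).+1%:R * dE.
Proof.
(* [B] dominates every [absz (q k)], so [q k + B] lies between 0 and 2B and 2B + 1 spin levels
   suffice. *)
move=> dE0; pose q k := Num.floor (e k / dE); pose B := (\sum_k absz (q k))%N.
have qB k : (absz (q k) <= B)%N by rewrite /B (bigD1 k)//= leq_addr.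
have lev_lt k : (absz (q k + B%:Z)%R < (B + B).+1)%N by have := qB k; lia.
exists (B + B)%N, (fun k => Ordinal (lev_lt k)) => k h [z ehk] /=.
have levE x : (absz (q x + B%:Z))%:R = (q x)%:~R + B%:R :> R.
  have -> : (q x)%:~R + B%:R = (q x + B%:Z)%:~R :> R by rewrite intrD.
  by rewrite -[in RHS](@gez0_abs (q x + B%:Z))//; have := qB x; lia.
have ehE : e h = e k + z%:~R * dE by rewrite -ehk; ring.
have qh : q h = q k + z.
  by rewrite /q ehE mulrDl mulfK ?gt_eqF// floorDrz ?intr_int// intrKfloor.
by rewrite -!natr1 !levE qh intrD ehE; ring.
Qed.

(* N k copies of each level k of the original bath, moved to the spin level
   lev k, together with one idle copy of every spin level. *)
Section enlarged_bath.
Variables (R : realType) (n : nat) (HS : 'M[R[i]]_n) (T : \bar R) (dE : R).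
Variables (m m' : nat) (lev : 'I_m -> 'I_m') (N : 'I_m -> nat).
Variable W : 'I_m -> 'I_m -> 'M[R[i]]_n.

Let K : finType := ({k : 'I_m & 'I_(N k)} + 'I_m')%type.

Definition enlarged_level (x : K) : 'I_m' :=
  match x with inl p => lev (tag p) | inr j => j end.

(** Only copies with the same number interact: a direct sum of replicas of the bath, replica a
    keeping the levels with more than a copies, and an idle part. *)
Definition enlarged_blocks (x y : K) : 'M[R[i]]_n :=
  match x, y with
  | inl p, inl q => if (tagged p == tagged q :> nat) then W (tag p) (tag q) else 0
  | inr i, inr j => (i == j)%:R%:M
  | _, _ => 0
  end.

Lemma big_sigma_ord (V : nmodType) (F : 'I_m -> nat -> V) :
  \sum_(p : {k : 'I_m & 'I_(N k)}) F (tag p) (tagged p) =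
  \sum_k \sum_(a < N k) F k a.
Proof. by rewrite sig_big_dep. Qed.

Lemma sum_ord_pick (V : nmodType) b a (v : V) : (a < b)%N ->
  \sum_(c < b) (if a == c :> nat then v else 0) = v.
Proof.
move=> ab; rewrite (bigD1 (Ordinal ab))//= eqxx big1 ?addr0// => c.
by rewrite -val_eqE /= eq_sym => /negbTE ->.
Qed.

(** Level k has a copy numbered a only if [a < N k]; the hypothesis ensures that absent copies omit
    only zero terms. *)
Lemma sum_sigma_pick (V : nmodType) a (F : 'I_m -> V) :
  (forall k, F k != 0 -> (a < N k)%N) ->
  \sum_(p : {k : 'I_m & 'I_(N k)}) (if a == tagged p :> nat then F (tag p) else 0)
  = \sum_k F k.
Proof.
move=> Fa; rewrite (big_sigma_ord (fun k c => if a == c then F k else 0)).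
apply: eq_bigr => k _; have [->|/Fa/sum_ord_pick//] := eqVneq (F k) 0.
by apply: big1 => c _; case: ifP.
Qed.

Hypothesis N_cst : forall k h, W k h != 0 -> N k = N h.

(** By [N_cst], a replica containing a level contains every level coupled to it, so no term of the
    unitarity sums is lost. Conservation holds because gaps are preserved wherever [W] is
    nonzero. *)
Lemma enlarged_energy_blocks (e : 'I_m -> R) :
  (forall k h, W k h != 0 ->
    (lev h).+1%:R * dE - (lev k).+1%:R * dE = e h - e k) ->
  energy_blocks HS e W ->
  energy_blocks HS (fun x => (enlarged_level x).+1%:R * dE) enlarged_blocks.
Proof.
move=> levW [Wu Wc]; split; last first.
  move=> [p|i] [q|j] /=; rewrite ?mulmx0 ?mul0mx ?subr0 ?scaler0//.
    case: ifP => _; last by rewrite mulmx0 mul0mx subr0 scaler0.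
    have [->|W0] := eqVneq (W (tag p) (tag q)) 0.
      by rewrite mulmx0 mul0mx subr0 scaler0.
    by rewrite levW// Wc.
  have [->|_] := eqVneq i j; first by rewrite mulmx1 mul1mx !subrr scale0r.
  by rewrite /= raddf0 mulmx0 mul0mx subr0 scaler0.
have adj0 : (0 : 'M[R[i]]_n)^t* = 0 by rewrite trmx0 map_mx0.
have sc0 : false%:R%:M = 0 :> 'M[R[i]]_n by rewrite -scalemx1 scale0r.
move=> x y; rewrite big_sumType /=.
case: x y => [p|i] [q|j] /=.
- rewrite [X in _ + X]big1 ?addr0 => [|l _]; last by rewrite mul0mx.
  transitivity (if tagged p == tagged q :> nat then
      \sum_l W (tag p) l *m (W (tag q) l)^t* else 0).
    case: eqP => [pq|pq].
      rewrite -(@sum_sigma_pick _ (tagged p) (fun l => W (tag p) l *m (W (tag q) l)^t*)).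
        by apply: eq_bigr => l _; rewrite -pq; case: ifP => // _; rewrite mul0mx.
      move=> l; have [->|/N_cst <- _] := eqVneq (W (tag p) l) 0.
        by rewrite mul0mx eqxx.
      exact: ltn_ord.
    apply: big1 => l _; case: eqP => [pl|_]; last by rewrite mul0mx.
    case: eqP => [ql|_]; last by rewrite adj0 mulmx0.
    by case: pq; rewrite pl ql.
  rewrite Wu; case: p q => k a [h b] /=.
  (* Copies of different levels have positions of different types, so equality of pairs is compared
     only once [k = h] is substituted. *)
  have [kh|kh] := eqVneq k h.
    case: _ / kh b => b; rewrite (inj_eq (@inl_inj _ _)) eq_Tagged /= -val_eqE /=.
    by case: eqP => //; rewrite raddf0.
  have -> : (inl (existT _ k a) == inl (existT _ h b) :> K) = false.
    by apply/negbTE; apply: contra_neq kh => -[].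
  by rewrite sc0 if_same.
- by rewrite sc0 !big1 ?addr0// => l _; rewrite ?adj0 ?mulmx0 ?mul0mx.
- by rewrite sc0 !big1 ?addr0// => l _; rewrite ?adj0 ?mulmx0 ?mul0mx.
- rewrite [X in X + _]big1 ?add0r => [|l _]; last by rewrite mul0mx.
  rewrite (inj_eq (@inr_inj _ _)) (bigD1 j)//= eqxx trmx1 map_mx1 mulmx1.
  rewrite big1 ?addr0// => l lj.
  by rewrite [j == l]eq_sym (negbTE lj) raddf0 adj0 mulmx0.
Qed.

Let w k := boltzmann T ((lev k).+1%:R * dE).
Let w' (j : 'I_m') := boltzmann T (j.+1%:R * dE).
Let Z := \sum_k (N k)%:R * w k + \sum_j w' j.

(** All copies of level k contribute the same term, whence the factor [N k]; idle levels contribute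
    the identity channel. *)
Lemma enlarged_bath_map X :
  bath_map T (fun x => (enlarged_level x).+1%:R * dE) enlarged_blocks X =
  \sum_k ((N k)%:R * w k / Z)%:C *: (\sum_h W h k *m X *m (W h k)^t*) +
  (\sum_j w' j / Z)%:C *: X.
Proof.
have adj0 : (0 : 'M[R[i]]_n)^t* = 0 by rewrite trmx0 map_mx0.
have ZE : \sum_x boltzmann T ((enlarged_level x).+1%:R * dE) = Z.
  rewrite big_sumType /=; congr (_ + _).
  rewrite (big_sigma_ord (fun k _ => w k)); apply: eq_bigr => k _.
  by rewrite sumr_const card_ord mulr_natl.
rewrite /bath_map ZE big_sumType /=; congr (_ + _).
  transitivity (\sum_(p : {k : 'I_m & 'I_(N k)})
    (w (tag p) / Z)%:C *: \sum_h W h (tag p) *m X *m (W h (tag p))^t*).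
    apply: eq_bigr => p _; congr (_ *: _); rewrite big_sumType /=.
    rewrite [X in _ + X]big1 ?addr0 => [|l _]; last by rewrite !mul0mx.
    rewrite -(@sum_sigma_pick _ (tagged p)
      (fun h => W h (tag p) *m X *m (W h (tag p))^t*)).
      by apply: eq_bigr => q _; rewrite eq_sym; case: ifP => // _; rewrite !mul0mx.
    move=> h; have [->|/N_cst -> _] := eqVneq (W h (tag p)) 0.
      by rewrite !mul0mx eqxx.
    exact: ltn_ord.
  rewrite (big_sigma_ord (fun k _ => (w k / Z)%:C *:
    \sum_h W h k *m X *m (W h k)^t*)).
  apply: eq_bigr => k _; rewrite sumr_const card_ord -scaler_nat scalerA.
  congr (_ *: _); rewrite -[_ * _ / _]mulrA [RHS]rmorphM rmorph_nat.
  reflexivity.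
rewrite rmorph_sum scaler_suml; apply: eq_bigr => j _.
congr (_ *: _); rewrite big_sumType /= [X in X + _]big1 ?add0r => [|l _]; last first.
  by rewrite !mul0mx.
rewrite (bigD1 j)//= eqxx trmx1 map_mx1 mulmx1 mul1mx big1 ?addr0// => l lj.
by rewrite (negbTE lj) raddf0 !mul0mx.
Qed.

End enlarged_bath.

(** * Limits of the Gibbs weights and of linear maps *)

Lemma cvg_truncn_div (R : realType) (b : R) : 0 <= b ->
  (Num.truncn (t.+1%:R * b))%:R / t.+1%:R @[t --> \oo] --> b.
Proof.
(* Truncation loses less than 1, hence less than [harmonic t], which is 1 / (t + 1), after the
   division. *)
move=> b0; apply: (@squeeze_cvgr _ _ _ _ (fun t => b - harmonic t) (fun=> b)).
- apply: nearW => t /=; have t0 : (0 : R) < t.+1%:R by rewrite ltr0n.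
  have tb : 0 <= t.+1%:R * b by rewrite mulr_ge0// ltW.
  rewrite ler_pdivlMr// ler_pdivrMr// mulrBl mulVf ?gt_eqF// [b * _]mulrC.
  by rewrite truncn_le tb lerBlDr natr1 ltW// truncnS_gt.
- rewrite -[X in _ --> X]subr0; apply: cvgB; [exact: cvg_cst|exact: cvg_harmonic].
- exact: cvg_cst.
Qed.

(** The entries of [lin_mx] are entries of images of basis matrices, so pointwise convergence of the
    maps is enough. *)
Lemma cvg_lin_mx (R : realType) n (F : nat -> superop R n) (G : superop R n) :
  (forall X i j, F t X i j @[t --> \oo] --> G X i j) ->
  lin_mx (F t : _ -> _) @[t --> \oo] --> lin_mx (G : _ -> _).
Proof.
move=> FG; apply: cvg_mx => p q.
case/mxvec_indexP: q => i j.
have E (H : superop R n) : lin_mx (H : _ -> _) p (mxvec_index i j) =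
    H (vec_mx (delta_mx 0 p)) i j by rewrite mxE /= mxvecE.
by rewrite E; under eq_fun do rewrite E; exact: FG.
Qed.

Lemma boltzmann_gt0 (R : realType) (T : \bar R) (x : R) : 0 < boltzmann T x.
Proof. exact: expR_gt0. Qed.

Lemma boltzmannD (R : realType) (T : \bar R) (x y : R) :
  boltzmann T (x + y) = boltzmann T x * boltzmann T y.
Proof. by rewrite /boltzmann mulrDr expRD. Qed.

(** After dividing numerator and denominator by t + 1, the copy numbers tend to [b], the fixed idle
    weights vanish and the normalisation tends to [Z0]. *)
Lemma cvg_weights (R : realType) m m' (b w : 'I_m -> R) (w' : 'I_m' -> R)
    (N := fun t k => Num.truncn (t.+1%:R * b k))
    (Z := fun t => \sum_k (N t k)%:R * w k + \sum_j w' j)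
    (Z0 := \sum_k b k * w k) :
  (forall k, 0 <= b k) -> Z0 != 0 ->
  (forall k, (N t k)%:R * w k / Z t @[t --> \oo] --> b k * w k / Z0) /\
  (\sum_j w' j / Z t @[t --> \oo] --> (0 : R)).
Proof.
move=> b0 Z0n0; pose z t := Z t / t.+1%:R.
have divz t x : x / Z t = (x / t.+1%:R) / z t.
  by rewrite /z invf_div mulrA divfK// pnatr_eq0.
have zE : z = fun t => \sum_k (N t k)%:R / t.+1%:R * w k + \sum_j harmonic t * w' j.
  apply/funext => t; rewrite /z /Z mulrDl !mulr_suml.
  by congr (_ + _); apply: eq_bigr => ? _; [rewrite mulrAC|rewrite mulrC].
have Nb k : (N t k)%:R / t.+1%:R * w k @[t --> \oo] --> b k * w k.
  by apply: cvgM; [exact: cvg_truncn_div|exact: cvg_cst].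
have w'0 j : harmonic t * w' j @[t --> \oo] --> (0 : R).
  by rewrite -[X in _ --> X](mul0r (w' j)); apply: cvgM;
    [exact: cvg_harmonic|exact: cvg_cst].
have zZ0 : z @ \oo --> Z0.
  rewrite zE -[X in _ --> X]addr0; apply: cvgD; first exact: cvg_sumr.
  (* The limit 0 is written as a sum of zeros so that [cvg_sumr] applies. *)
  by rewrite -[X in _ --> X](@big1 _ _ +%R 'I_m' (index_enum _) xpredT (fun=> 0))//;
    exact: cvg_sumr.
split=> [k|].
  under eq_fun do rewrite divz [_ * w k / _]mulrAC.
  by apply: cvgM; [exact: Nb|exact: cvgV].
have w'Z j : w' j / Z t @[t --> \oo] --> (0 : R).
  have -> : (fun t => w' j / Z t) = (fun t => harmonic t * w' j / z t).
    by apply/funext => t; rewrite divz [w' j / _]mulrC.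
  by rewrite -[X in _ --> X](mul0r Z0^-1); apply: cvgM; [exact: w'0|exact: cvgV].
by rewrite -[X in _ --> X](@big1 _ _ +%R 'I_m' (index_enum _) xpredT (fun=> 0))//;
  exact: cvg_sumr.
Qed.

(** The shift [s k] multiplies a Boltzmann weight by [boltzmann T (- s k)]; a copy number growing
    like [boltzmann T (s k)] times t cancels this factor in the limit. *)
Lemma bath_map_closure (R : realType) n (HS : 'M[R[i]]_n) (E1 dE : R)
    (T : \bar R) m (e : 'I_m -> R) (W : 'I_m -> 'I_m -> 'M[R[i]]_n)
    (F : superop R n) :
  HS \is hermsymmx -> 0 < dE ->
  (forall a : R[i], eigenvalue HS a -> exists j : nat, a = (E1 + j%:R * dE)%:C) ->
  (0 < m)%N -> energy_blocks HS e W -> F =1 bath_map T e W ->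
  superop_closure (TO_spin HS dE T) F.
Proof.
move=> hHS dE0 spec m0 We FE.
have [m' [lev levP]] := lattice_shift e dE0.
pose s k := e k - (lev k).+1%:R * dE.
pose N t k := Num.truncn (t.+1%:R * boltzmann T (s k)).
have levW k h : W k h != 0 -> s k = s h.
  by move=> W0; apply: levP; exact: energy_gap hHS spec W0 (We.2 k h).
have N_cst t k h : W k h != 0 -> N t k = N t h by move=> /levW; rewrite /N => ->.
have /choice[G GP] : forall t, exists G : superop R n, TO_spin HS dE T G /\
    G =1 bath_map T (fun x => (enlarged_level lev x).+1%:R * dE)
      (@enlarged_blocks R n m m'.+1 (N t) W).
  move=> t; have [//|j||G GT GE] := @bath_map_spin _ _ HS dE T m'.+1 _
    (@enlarged_level m m'.+1 lev (N t)) (@enlarged_blocks R n m m'.+1 (N t) W).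
  (* The idle copy occupies spin level j even if [lev] misses it. *)
  - by exists (inr j).
  - apply: (enlarged_energy_blocks (N_cst t) _ We) => k h /levW.
    rewrite /s => sE; move: (e k) (e h) sE => x y; lra.
  - by exists G.
suff FG : lin_mx (G t : _ -> _) @[t --> \oo] --> lin_mx (F : _ -> _).
  apply: (closed_cvg _ (@closed_closure _ _) _ _ FG).
  by apply: nearW => t; apply: subset_closure; exists (G t) => //; exact: (GP t).1.
apply: cvg_lin_mx => X i j.
pose w k := boltzmann T ((lev k).+1%:R * dE).
pose w' (j : 'I_m'.+1) := boltzmann T (j.+1%:R * dE).
have bw k : boltzmann T (s k) * w k = boltzmann T (e k).
  by rewrite -boltzmannD subrK.
(* By [bw] this is the original partition function, positive because the bath has a level. *)
have Z0 : \sum_k boltzmann T (s k) * w k != 0.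
  rewrite gt_eqF// (bigD1 (Ordinal m0))//= ltr_pwDl ?bw ?boltzmann_gt0//.
  by apply: sumr_ge0 => k _; rewrite bw ltW ?boltzmann_gt0.
have [cvgN cvgw'] := cvg_weights w' (fun k => ltW (boltzmann_gt0 T (s k))) Z0.
rewrite FE /bath_map summxE.
pose Z t := \sum_k (N t k)%:R * w k + \sum_j w' j.
pose M k := \sum_h W h k *m X *m (W h k)^t*.
have -> : (fun t => G t X i j) = (fun t =>
    \sum_k ((N t k)%:R * w k / Z t)%:C * M k i j +
    (\sum_j w' j / Z t)%:C * X i j).
  apply/funext => t; rewrite (GP t).2 (enlarged_bath_map T dE lev (N_cst t)).
  by rewrite mxE summxE mxE; congr (_ + _); apply: eq_bigr => k _; rewrite mxE.
rewrite -[X in _ --> X]addr0; apply: cvgD.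
  apply: cvg_sumr => k; rewrite mxE; apply: cvgM; last exact: cvg_cst.
  apply: cvg_real_complex; rewrite -bw.
  under [X in _ / X]eq_bigr do rewrite -bw.
  exact: cvgN.
rewrite -[X in _ --> X](mul0r (X i j)); apply: cvgM; last exact: cvg_cst.
exact: cvg_real_complex.
Qed.

(** * Comparison of the closures *)

Lemma superop_closureS (R : realType) n (A B : set (superop R n)) :
  A `<=` B -> superop_closure A `<=` superop_closure B.
Proof. by move=> AB F; apply: closureS => _ [G /AB BG <-]; exists G. Qed.

Lemma superop_closure_sub (R : realType) n (A B : set (superop R n)) :
  A `<=` superop_closure B -> superop_closure A `<=` superop_closure B.
Proof.
(* The target closure is replaced by its own closure, which reduces the claim to monotonicity. *)
move=> AB F; rewrite /superop_closure /= [X in _ -> X (lin_mx F)](closure_id _).1; last first.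
  exact: closed_closure.
by apply: closureS => _ [G /AB BG <-].
Qed.

Theorem corollary5 (R : realType) (n : nat) (hn : (0 < n)%N)
    (HS : 'M[R[i]]_n) (hHS : HS \is hermsymmx)
    (E1 dE : R) (hdE : 0 < dE)
    (hspec : forall a : R[i], eigenvalue HS a ->
       exists j : nat, a = (E1 + j%:R * dE)%:C)
    (T : \bar R) (hT : (0 < T)%E) :
  superop_closure (TO_spin HS dE T) = superop_closure (TO_spin0 HS dE T) /\
  superop_closure (TO HS T) = superop_closure (TO_spin HS dE T).
Proof.
have s01 : TO_spin HS dE T `<=` TO_spin0 HS dE T.
  move=> F [m [beta [H [m0 b0 hH cH FE]]]]; exists m, beta, H; split=> //.
  by rewrite (bigD1 (Ordinal m0))//= addn_gt0 b0.
have TOc : TO HS T `<=` superop_closure (TO_spin HS dE T).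
  move=> F /TO_bath_map[m [e [W [m0 We FE]]]].
  exact: bath_map_closure hHS hdE hspec m0 We FE.
have c01 := superop_closureS s01.
have c1T := superop_closureS (@TO_spin0_sub_TO R n HS dE T).
have cT0 := superop_closure_sub TOc.
(* The inclusions run in a cycle from [TO_spin] through [TO_spin0] and [TO] back to [TO_spin], so
   all three closures coincide. *)
split; apply/seteqP; split=> //.
- exact: subset_trans c1T cT0.
- exact: subset_trans c01 c1T.
Qed.
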